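(* Let $\alpha>-1$. For all $n,m\in\mathbb{N}_0$ and all $t\in\mathbb{R}$, $$e^{-\mathrm{i}tH_\alpha}(n,m)=e^{-\mathrm{i}tH_\alpha}(m,n)=\frac{1}{(1+\mathrm{i}t)^{1+\alpha}}\left(\frac{t+\mathrm{i}}{t-\mathrm{i}}\right)^{n}\left(\frac{t}{\mathrm{i}-t}\right)^{m-n}\frac{\sigma_\alpha(m)}{\sigma_\alpha(n)}\,P_n^{(\alpha,m-n)}\!\left(\frac{t^2-1}{t^2+1}\right),$$ where for $t=0$ and $m<n$ the right-hand side is understood as its continuous extension to $t=0$.
   Context: $\mathbb{N}_0=\{0,1,2,\dots\}$. For $\alpha>-1$, $H_\alpha$ is the (self-adjoint) operator in $\ell^2(\mathbb{N}_0)$ with maximal domain $\{u\in\ell^2(\mathbb{N}_0): \tau_\alpha u\in\ell^2(\mathbb{N}_0)\}$ acting by $H_\alpha u=\tau_\alpha u$, where $$(\tau_\alpha u)_n=\sqrt{n(n+\alpha)}\,u_{n-1}+(2n+1+\alpha)u_n+\sqrt{(n+1)(n+1+\alpha)}\,u_{n+1},\qquad u_{-1}:=0.$$ $e^{-\mathrm{i}tH_\alpha}$ is the associated unitary group and $e^{-\mathrm{i}tH_\alpha}(n,m)=\langle\delta_n,e^{-\mathrm{i}tH_\alpha}\delta_m\rangle$ is its matrix entry (kernel) with respect to the standard basis $(\delta_n)_{n\ge0}$. $\sigma_\alpha(n)=\binom{n+\alpha}{n}^{1/2}$ with $\binom{n+\alpha}{n}=\frac{(\alpha+1)(\alpha+2)\cdots(\alpha+n)}{n!}$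 (equal to $1$ for $n=0$). Complex powers are principal branches. The Jacobi polynomials are defined for $n\in\mathbb{N}_0$ and all real $\alpha,\beta$ by $$P_n^{(\alpha,\beta)}(x)=\sum_{k=0}^n\binom{n+\alpha}{n-k}\binom{n+\beta}{k}\left(\frac{x-1}{2}\right)^k\left(\frac{x+1}{2}\right)^{n-k},$$ where $\binom{z}{k}=z(z-1)\cdots(z-k+1)/k!$. *)

(* Defs.v *)
From Stdlib Require Export Reals Factorial.
From Coquelicot Require Export Coquelicot.
Open Scope R_scope.

(** * The Hilbert space l^2(N_0), with inner product antilinear on the left *)

Definition ell2 (u : nat -> C) : Prop :=
  ex_series (fun n => Cmod (u n) ^ 2).

Definition l2norm (u : nat -> C) : R :=
  sqrt (Series (fun n => Cmod (u n) ^ 2)).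

Definition inner (u v : nat -> C) : C :=
  (Series (fun n => Re (Cconj (u n) * v n)%C),
   Series (fun n => Im (Cconj (u n) * v n)%C)).

Definition lcomb (a : C) (u : nat -> C) (b : C) (v : nat -> C) : nat -> C :=
  fun n => (a * u n + b * v n)%C.

Definition l2diff (u v : nat -> C) : nat -> C := fun n => (u n - v n)%C.

Definition delta (m : nat) : nat -> C :=
  fun n => if Nat.eqb n m then RtoC 1 else RtoC 0.

(** * Unbounded operators and unitary groups
    An operator is a domain with an action; the values of [op_act] outside
    [op_dom] are irrelevant.  Likewise a bounded operator on l^2 is a map on
    sequences of which only the values on [ell2] matter. *)

Record operator := Operator {
  op_dom : (nat -> C) -> Prop;
  op_act : (nat -> C) -> nat -> C
}.

Record unitary (V : (nat -> C) -> nat -> C) : Prop := {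
  unitary_ell2 : forall u, ell2 u -> ell2 (V u);
  unitary_linear : forall a u b v, ell2 u -> ell2 v ->
    V (lcomb a u b v) = lcomb a (V u) b (V v);
  unitary_inner : forall u v, ell2 u -> ell2 v ->
    inner (V u) (V v) = inner u v;
  unitary_surj : forall w, ell2 w -> exists u, ell2 u /\ V u = w
}.

Record unitary_group (U : R -> (nat -> C) -> nat -> C) : Prop := {
  ugroup_unitary : forall t, unitary (U t);
  ugroup_0 : forall u, ell2 u -> U 0 u = u;
  ugroup_plus : forall s t u, ell2 u -> U (s + t) u = U s (U t u);
  ugroup_continuous : forall u s, ell2 u ->
    filterlim (fun t => l2norm (l2diff (U t u) (U s u)))
      (locally s) (locally 0)
}.

(** The strong derivative of [U] at time [0] on [u] exists and equals [v]. *)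
Definition generator_graph (U : R -> (nat -> C) -> nat -> C)
    (u v : nat -> C) : Prop :=
  ell2 u /\ ell2 v /\
  filterlim
    (fun t => l2norm (fun n => ((U t u n - u n) / RtoC t - v n)%C))
    (locally' 0) (locally 0).

(** [U t] is [exp (- i t A)]: the strongly continuous unitary group whose
    generator is [- i A], with equality of domains.  By Stone's theorem there
    is exactly one such group on l^2 when [A] is self-adjoint. *)
Definition is_unitary_group_of (A : operator)
    (U : R -> (nat -> C) -> nat -> C) : Prop :=
  unitary_group U /\
  forall u v, generator_graph U u v <->
    (op_dom A u /\ v = (fun n => - Ci * op_act A u n)%C).

Definition kernel (V : (nat -> C) -> nat -> C) (n m : nat) : C :=
  inner (delta n) (V (delta m)).

(** * The operator H_alpha *)

Definition tau (alpha : R) (u : nat -> C) (n : nat) : C :=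
  (RtoC (sqrt (INR n * (INR n + alpha)))
     * match n with O => RtoC 0 | S k => u k end
   + RtoC (2 * INR n + 1 + alpha) * u n
   + RtoC (sqrt ((INR n + 1) * (INR n + 1 + alpha))) * u (S n))%C.

Definition H_op (alpha : R) : operator := {|
  op_dom := fun u => ell2 u /\ ell2 (tau alpha u);
  op_act := tau alpha
|}.

(** * Principal complex powers *)

(** For [z <> 0] the argument lies in [(-PI, PI]]. *)
Definition Carg (z : C) : R :=
  if Rle_dec 0 (Im z) then acos (Re z / Cmod z) else - acos (Re z / Cmod z).

Definition Clog (z : C) : C := (ln (Cmod z), Carg z).

Definition Cexp (z : C) : C :=
  (exp (Re z) * cos (Im z), exp (Re z) * sin (Im z)).

Definition Cpower (z w : C) : C := Cexp (w * Clog z)%C.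

Definition CpowZ (z : C) (k : Z) : C :=
  match k with
  | Z0 => RtoC 1
  | Zpos p => Cpow z (Pos.to_nat p)
  | Zneg p => (/ Cpow z (Pos.to_nat p))%C
  end.

(** * Generalised binomials, sigma_alpha and Jacobi polynomials *)

Fixpoint falling (z : R) (k : nat) : R :=
  match k with
  | O => 1
  | S j => falling z j * (z - INR j)
  end.

Definition gbinom (z : R) (k : nat) : R := falling z k / INR (fact k).

Definition sigma (alpha : R) (n : nat) : R := sqrt (gbinom (INR n + alpha) n).

Definition jacobi (n : nat) (alpha beta x : R) : R :=
  sum_f_R0 (fun k =>
    gbinom (INR n + alpha) (n - k) * gbinom (INR n + beta) k
      * ((x - 1) / 2) ^ k * ((x + 1) / 2) ^ (n - k)) n.

(** The closed form of the kernel; meaningless for [t = 0] and [m < n], where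
    a negative power of [0] occurs. *)
Definition kernel_formula (alpha : R) (n m : nat) (t : R) : C :=
  (1 / Cpower (1 + Ci * RtoC t) (RtoC (1 + alpha))
   * Cpow ((RtoC t + Ci) / (RtoC t - Ci)) n
   * CpowZ (RtoC t / (Ci - RtoC t)) (Z.of_nat m - Z.of_nat n)
   * RtoC (sigma alpha m / sigma alpha n)
   * RtoC (jacobi n alpha (INR m - INR n) ((t ^ 2 - 1) / (t ^ 2 + 1))))%C.

(* Main.v *)
Require Import Defs.
From Stdlib Require Import Reals Arith ZArith Lra Lia FunctionalExtensionality.
From Coquelicot Require Import Coquelicot.
Open Scope R_scope.

(** Since finite sequences lie in the domain, the entries
    [k(n,m)(t) = <delta_n, U_t delta_m>] satisfy, for fixed [n], the system
    [k(n,m)' = - i (a_m k(n,m-1) + b_m k(n,m) + a_(m+1) k(n,m+1))] with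
    [k(n,m)(0) = delta_(nm)] and [|k(n,m)| <= 1].

    Put [q = 1 / (1 + i t)] and [w = q - 1 = t / (i - t)].  Then
    [(t + i) / (t - i) = 1 - 2 q], and multiplying it by [(x - 1) / 2] and
    [(x + 1) / 2], where [x = (t^2 - 1) / (t^2 + 1)], gives [q^2] and [w^2].
    The closed form becomes the function
    [q^(1+alpha) s_n s_m sum_k q^(2k) w^(n+m-2k) / ((alpha+1)_k k! (n-k)! (m-k)!)],
    [s_n^2 = (alpha+1)_n n!], which is symmetric in [n] and [m], defined for
    all [t], and solves the same system (by a telescoping sum).

    For [m = 0] the two solutions agree: with [psi_j] the explicit solution
    for the indices [0, j], the truncated pairing
    [sum_(j <= N) k(n,j)(t - s) psi_j(s)] interpolates between them as [s] runs
    from [0] to [t], and its [s]-derivative consists of boundary terms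
    of order [a_(N+1) |psi_N|], which tend to [0] since [|w| < 1].  The system
    then determines [k(n,m+1)] from [k(n,m)] and [k(n,m-1)], as [a_(m+1) <> 0]. *)

(** * Complex-valued derivatives and uniqueness for Jacobi evolutions *)

(** Componentwise, so that real differentiation rules and the real mean value inequality apply to
    each part. *)
Definition is_Cderive (f : R -> C) (t : R) (l : C) : Prop :=
  is_derive (fun s => Re (f s)) t (Re l) /\ is_derive (fun s => Im (f s)) t (Im l).

Lemma is_Cderive_eq (f : R -> C) (t : R) (l l' : C) :
  is_Cderive f t l -> l = l' -> is_Cderive f t l'.
Proof. now intros H <-. Qed.

Lemma is_Cderive_ext (f g : R -> C) (t : R) (l : C) :
  (forall s, f s = g s) -> is_Cderive f t l -> is_Cderive g t l.
Proof.
  intros E [H1 H2]; split; eapply is_derive_ext; eauto; intros s; simpl; now rewrite E.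
Qed.

Lemma is_Cderive_unique (f : R -> C) (t : R) (l l' : C) :
  is_Cderive f t l -> is_Cderive f t l' -> l = l'.
Proof.
  intros [H1 H2] [H3 H4].
  apply is_derive_unique in H1, H2, H3, H4.
  destruct l, l'; simpl in *; congruence.
Qed.

Lemma is_Cderive_const (c : C) (t : R) : is_Cderive (fun _ => c) t 0.
Proof. split; apply (is_derive_const (K := R_AbsRing) (V := R_NormedModule)). Qed.

Lemma is_Cderive_plus (f g : R -> C) (t : R) (l k : C) :
  is_Cderive f t l -> is_Cderive g t k ->
  is_Cderive (fun s => f s + g s)%C t (l + k)%C.
Proof.
  intros [H1 H2] [H3 H4]; split.
  - exact (is_derive_plus _ _ _ _ _ H1 H3).
  - exact (is_derive_plus _ _ _ _ _ H2 H4).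
Qed.

Lemma is_Cderive_mult (f g : R -> C) (t : R) (l k : C) :
  is_Cderive f t l -> is_Cderive g t k ->
  is_Cderive (fun s => f s * g s)%C t (l * g t + f t * k)%C.
Proof.
  intros [H1 H2] [H3 H4]; split.
  - replace (Re (l * g t + f t * k)%C) with
      (minus (plus (mult (Re l) (Re (g t))) (mult (Re (f t)) (Re k)))
             (plus (mult (Im l) (Im (g t))) (mult (Im (f t)) (Im k))));
      [|unfold minus, plus, opp, mult; simpl; unfold Re, Im; ring].
    apply @is_derive_minus; apply @is_derive_mult; auto; exact Rmult_comm.
  - replace (Im (l * g t + f t * k)%C) with
      (plus (plus (mult (Re l) (Im (g t))) (mult (Re (f t)) (Im k)))
            (plus (mult (Im l) (Re (g t))) (mult (Im (f t)) (Re k))));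
      [|unfold plus, mult; simpl; unfold Re, Im; ring].
    apply @is_derive_plus; apply @is_derive_mult; auto; exact Rmult_comm.
Qed.

Lemma is_Cderive_scal (c : C) (f : R -> C) (t : R) (l : C) :
  is_Cderive f t l -> is_Cderive (fun s => c * f s)%C t (c * l)%C.
Proof.
  intros H; eapply is_Cderive_eq;
    [exact (is_Cderive_mult _ _ _ _ _ (is_Cderive_const c t) H)|simpl; ring].
Qed.

Lemma is_Cderive_pow (f : R -> C) (t : R) (l : C) (n : nat) :
  is_Cderive f t l ->
  is_Cderive (fun s => f s ^ n)%C t (RtoC (INR n) * f t ^ pred n * l)%C.
Proof.
  intros H; induction n as [|n IH].
  - eapply is_Cderive_eq; [apply (is_Cderive_const 1)|simpl; ring].
  - eapply is_Cderive_eq; [exact (is_Cderive_mult _ _ _ _ _ H IH)|].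
    rewrite S_INR, RtoC_plus; destruct n; simpl; ring.
Qed.

Lemma is_Cderive_reflect (f : R -> C) (t s : R) (l : C) :
  is_Cderive f (t - s) l -> is_Cderive (fun r => f (t - r)) s (- l)%C.
Proof.
  assert (D : is_derive (fun r => t - r) s (-1)) by (auto_derive; [easy|ring]).
  intros [H1 H2]; split.
  - replace (Re (- l)%C) with (scal (-1) (Re l)); [|unfold scal; simpl; unfold mult, Re, Im; simpl; ring].
    exact (is_derive_comp (fun r => Re (f r)) _ _ _ _ H1 D).
  - replace (Im (- l)%C) with (scal (-1) (Im l)); [|unfold scal; simpl; unfold mult, Re, Im; simpl; ring].
    exact (is_derive_comp (fun r => Im (f r)) _ _ _ _ H2 D).
Qed.

Lemma is_Cderive_sum_n (f : nat -> R -> C) (df : nat -> C) (t : R) (n : nat) :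
  (forall k, is_Cderive (f k) t (df k)) ->
  is_Cderive (fun s => sum_n (fun k => f k s) n) t (sum_n df n).
Proof.
  intros H; induction n as [|n IH].
  - rewrite sum_O; eapply is_Cderive_ext; [|exact (H 0%nat)].
    intros s; now rewrite sum_O.
  - rewrite sum_Sn; eapply is_Cderive_ext; [|exact (is_Cderive_plus _ _ _ _ _ IH (H (S n)))].
    intros s; now rewrite sum_Sn.
Qed.

Lemma Cmod_le_Re_Im (z : C) : Cmod z <= Rabs (Re z) + Rabs (Im z).
Proof.
  apply Rsqr_incr_0_var;
    [|generalize (Rabs_pos (Re z)) (Rabs_pos (Im z)); lra].
  rewrite !Rsqr_pow2, Cmod2_alt.
  rewrite <- (pow2_abs (Re z)), <- (pow2_abs (Im z)).
  generalize (Rabs_pos (Re z)) (Rabs_pos (Im z)); nra.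
Qed.

Lemma im_le_Cmod (z : C) : Rabs (Im z) <= Cmod z.
Proof.
  apply Rsqr_incr_0_var; [|apply Cmod_ge_0].
  rewrite !Rsqr_pow2, Cmod2_alt, pow2_abs; generalize (pow2_ge_0 (Re z)); lra.
Qed.

(** The real mean value inequality is used on the real and imaginary parts separately, which costs
    the factor 2. *)
Lemma is_Cderive_bounded_variation (f df : R -> C) (D t : R) :
  (forall s, Rabs s <= Rabs t -> is_Cderive f s (df s) /\ Cmod (df s) <= D) ->
  Cmod (f t - f 0)%C <= 2 * D * Rabs t.
Proof.
  intros H.
  assert (B1 : Rabs (Re (f t) - Re (f 0)) <= D * Rabs (t - 0)).
  { apply (bounded_variation (fun s => Re (f s)) (fun s => Re (df s))); intros s; rewrite !Rminus_0_r.
    intros Hs; destruct (H s Hs) as [[H1 H2] H3]; split; [easy|].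
    eapply Rle_trans; [apply re_le_Cmod|easy]. }
  assert (B2 : Rabs (Im (f t) - Im (f 0)) <= D * Rabs (t - 0)).
  { apply (bounded_variation (fun s => Im (f s)) (fun s => Im (df s))); intros s; rewrite !Rminus_0_r.
    intros Hs; destruct (H s Hs) as [[H1 H2] H3]; split; [easy|].
    eapply Rle_trans; [apply im_le_Cmod|easy]. }
  rewrite Rminus_0_r in B1, B2.
  eapply Rle_trans; [apply Cmod_le_Re_Im|].
  change (Rabs (Re (f t) - Re (f 0)) + Rabs (Im (f t) - Im (f 0)) <= 2 * D * Rabs t).
  lra.
Qed.

Lemma is_Cderive_filterlim (f : R -> C) (t : R) (l : C) :
  is_Cderive f t l -> filterlim f (locally t) (locally (f t)).
Proof.
  intros [H1 H2].
  assert (C1 := ex_derive_continuous (V := R_NormedModule) _ _ (ex_intro _ _ H1)).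
  assert (C2 := ex_derive_continuous (V := R_NormedModule) _ _ (ex_intro _ _ H2)).
  intros P [eps HP].
  assert (E1 := C1 _ (locally_ball (Re (f t)) eps)).
  assert (E2 := C2 _ (locally_ball (Im (f t)) eps)).
  unfold filtermap in *.
  generalize (filter_and _ _ E1 E2); apply filter_imp.
  intros s [A B]; apply HP; split; easy.
Qed.

Lemma sum_n_delta_l (f : nat -> C) (j N : nat) :
  (j <= N)%nat -> sum_n (fun i => delta j i * f i)%C N = f j.
Proof.
  intros H.
  assert (Z : forall M, (M < j)%nat -> sum_n (fun i => delta j i * f i)%C M = RtoC 0).
  { intros M HM; induction M as [|M IH].
    - rewrite sum_O; unfold delta; destruct (Nat.eqb_spec 0 j); [lia|].
      change (RtoC 0 * f 0%nat = RtoC 0)%C; ring.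
    - rewrite sum_Sn, IH by lia; unfold delta; destruct (Nat.eqb_spec (S M) j); [lia|].
      change (RtoC 0 + RtoC 0 * f (S M) = RtoC 0)%C; ring. }
  induction H as [|N H IH].
  - destruct j as [|j].
    + rewrite sum_O; change (RtoC 1 * f 0%nat = f 0%nat)%C; ring.
    + rewrite sum_Sn, Z by lia; unfold delta; rewrite Nat.eqb_refl.
      change (RtoC 0 + RtoC 1 * f (S j) = f (S j))%C; ring.
  - rewrite sum_Sn, IH; unfold delta; destruct (Nat.eqb_spec (S N) j); [lia|].
    change (f j + RtoC 0 * f (S N) = f j)%C; ring.
Qed.

(** * Uniqueness for the Jacobi system by a truncated pairing *)

Section Uniqueness.

Variables (a b : nat -> R) (n : nat) (k psi : nat -> R -> C).

Hypothesis a0 : a 0%nat = 0.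
Hypothesis k_derive : forall m t, is_Cderive (k m) t
  (- Ci * (a m * k (pred m) t + b m * k m t + a (S m) * k (S m) t))%C.
Hypothesis psi_derive : forall m t, is_Cderive (psi m) t
  (- Ci * (a m * psi (pred m) t + b m * psi m t + a (S m) * psi (S m) t))%C.
Hypothesis k_bounded : forall m t, Cmod (k m t) <= 1.
Hypothesis k_0 : forall m, k m 0 = delta n m.
Hypothesis psi_0 : forall m, psi m 0 = delta 0 m.
Hypothesis psi_decay : forall T, exists eps : nat -> R, is_lim_seq eps 0 /\
  forall N s, Rabs s <= T -> Rabs (a (S N)) * (Cmod (psi N s) + Cmod (psi (S N) s)) <= eps N.

Definition truncated_pairing (t : R) (N : nat) (s : R) : C :=
  sum_n (fun j => k j (t - s) * psi j s)%C N.

(* All bulk terms cancel because the Jacobi matrix is symmetric; only the edge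
   terms at the truncation index survive. *)
Lemma truncated_pairing_derive (t : R) (N : nat) (s : R) :
  is_Cderive (truncated_pairing t N) s
    (Ci * a (S N) * (k (S N) (t - s) * psi N s - k N (t - s) * psi (S N) s))%C.
Proof.
  assert (D : forall j, is_Cderive (fun r => k j (t - r) * psi j r)%C s
    (Ci * (a j * k (pred j) (t - s) + b j * k j (t - s) + a (S j) * k (S j) (t - s)) * psi j s
     - Ci * (a j * psi (pred j) s + b j * psi j s + a (S j) * psi (S j) s) * k j (t - s))%C).
  { intros j; eapply is_Cderive_eq.
    - apply (is_Cderive_mult (fun r => k j (t - r))); [apply is_Cderive_reflect, k_derive|apply psi_derive].
    - simpl; ring. }
  induction N as [|N IH].
  - apply (is_Cderive_ext (fun r => k 0%nat (t - r) * psi 0%nat r)%C);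
      [intros r; unfold truncated_pairing; now rewrite sum_O|].
    eapply is_Cderive_eq; [apply (D 0%nat)|]. rewrite a0; simpl; ring.
  - apply (is_Cderive_ext
      (fun r => truncated_pairing t N r + k (S N) (t - r) * psi (S N) r)%C);
      [intros r; unfold truncated_pairing; now rewrite sum_Sn|].
    eapply is_Cderive_eq; [apply is_Cderive_plus; [exact IH|apply (D (S N))]|].
    simpl pred; ring.
Qed.

(** Row [n] of one solution is paired with row 0 of the other, hence the index 0 on the left and [n]
    on the right. Boundedness of [k] and decay of [psi] together make the edge terms vanish. *)
Lemma jacobi_evolution_unique (t : R) : k 0%nat t = psi n t.
Proof.
  destruct (psi_decay (Rabs t)) as [eps [Heps Hb]].
  assert (B : forall N, (n <= N)%nat -> Cmod (psi n t - k 0%nat t)%C <= 2 * eps N * Rabs t).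
  { intros N HN.
    (* At [s = t] the factors [k j 0] select [j = n], which needs [n <= N]; at [s = 0] the factors
       [psi j 0] select [j = 0]. *)
    assert (E1 : truncated_pairing t N t = psi n t).
    { unfold truncated_pairing.
      rewrite <- (sum_n_delta_l (fun i => psi i t) n N HN).
      apply sum_n_ext; intros i; now rewrite Rminus_diag, k_0. }
    assert (E2 : truncated_pairing t N 0 = k 0%nat t).
    { unfold truncated_pairing.
      rewrite <- (sum_n_delta_l (fun i => k i t) 0 N) by lia.
      apply sum_n_ext; intros i; now rewrite Rminus_0_r, psi_0, Cmult_comm. }
    rewrite <- E1, <- E2.
    eapply (is_Cderive_bounded_variation (truncated_pairing t N)); intros s Hs; split;
      [apply truncated_pairing_derive|].
    eapply Rle_trans; [|exact (Hb N s Hs)].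
    rewrite !Cmod_mult, Cmod_Ci, Rmult_1_l, Cmod_R.
    apply Rmult_le_compat_l; [apply Rabs_pos|].
    eapply Rle_trans; [apply Cmod_triangle|].
    rewrite Cmod_opp, !Cmod_mult.
    generalize (k_bounded (S N) (t - s)) (k_bounded N (t - s))
      (Cmod_ge_0 (psi N s)) (Cmod_ge_0 (psi (S N) s)); nra. }
  (* The left side of [B] does not depend on [N], so the limit in [N] forces it to be 0. *)
  assert (L : Rbar_le (Cmod (psi n t - k 0%nat t)%C) 0).
  { eapply (is_lim_seq_le_loc (fun _ => Cmod (psi n t - k 0%nat t)%C)
             (fun N => 2 * eps N * Rabs t)).
    - exists n; exact B.
    - apply is_lim_seq_const.
    - replace (Finite 0) with (Finite (2 * 0 * Rabs t)) by (f_equal; ring).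
      apply (is_lim_seq_scal_r _ (Rabs t) (2 * 0)).
      apply (is_lim_seq_scal_l eps 2 0 Heps). }
  simpl in L.
  assert (Z : (psi n t - k 0%nat t)%C = 0).
  { apply Cmod_eq_0, Rle_antisym; [exact L|apply Cmod_ge_0]. }
  replace (psi n t) with ((psi n t - k 0%nat t) + k 0%nat t)%C by ring.
  rewrite Z; ring.
Qed.

End Uniqueness.

(** * Generalised binomials *)

Lemma falling_add (z : R) (i j : nat) :
  falling z (i + j) = falling z i * falling (z - INR i) j.
Proof.
  induction j as [|j IH].
  - rewrite Nat.add_0_r; simpl; ring.
  - rewrite Nat.add_succ_r; simpl; rewrite IH, plus_INR; ring.
Qed.

(* The Pochhammer symbol [(alpha + 1)_k]. *)
Definition poch (alpha : R) (k : nat) : R := falling (INR k + alpha) k.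

Lemma poch_S (alpha : R) (k : nat) :
  poch alpha (S k) = (alpha + 1 + INR k) * poch alpha k.
Proof.
  unfold poch; change (S k) with (1 + k)%nat; rewrite falling_add, plus_INR.
  simpl; replace (1 + INR k + alpha - 1) with (INR k + alpha) by ring; ring.
Qed.

Lemma poch_pos (alpha : R) (k : nat) : -1 < alpha -> 0 < poch alpha k.
Proof.
  intros H; induction k as [|k IH]; [unfold poch; simpl; lra|].
  rewrite poch_S; apply Rmult_lt_0_compat; [generalize (pos_INR k); lra|easy].
Qed.

Lemma poch_0_fact (k : nat) : poch 0 k = INR (fact k).
Proof.
  induction k as [|k IH]; [unfold poch; simpl; lra|].
  rewrite poch_S, IH, fact_simpl, mult_INR, S_INR; ring.
Qed.

(** [poch alpha n] splits into its top [n - k] factors, the numerator of the binomial, and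
    [poch alpha k], which is nonzero since [alpha > -1]. *)
Lemma gbinom_poch (alpha : R) (n k : nat) : -1 < alpha -> (k <= n)%nat ->
  gbinom (INR n + alpha) (n - k) = poch alpha n / (poch alpha k * INR (fact (n - k))).
Proof.
  intros H Hk; unfold gbinom.
  assert (E : poch alpha n = falling (INR n + alpha) (n - k) * poch alpha k).
  { unfold poch at 1; rewrite <- (Nat.sub_add k n) at 2 by lia.
    rewrite falling_add; unfold poch; rewrite minus_INR by lia.
    do 2 f_equal; ring. }
  rewrite E; field; split; [apply INR_fact_neq_0|].
  generalize (poch_pos alpha k H); lra.
Qed.

(** The case [alpha = 0] of [gbinom_poch], with [m - k] for [k]. *)
Lemma gbinom_nat (m k : nat) : (k <= m)%nat ->
  gbinom (INR m) k = INR (fact m) / (INR (fact k) * INR (fact (m - k))).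
Proof.
  intros H.
  generalize (gbinom_poch 0 m (m - k) ltac:(lra) ltac:(lia)).
  rewrite Rplus_0_r, !poch_0_fact; replace (m - (m - k))%nat with k by lia.
  intros ->; f_equal; ring.
Qed.

Lemma gbinom_nat_0 (m k : nat) : (m < k)%nat -> gbinom (INR m) k = 0.
Proof.
  (* Isolates the factor [INR m - INR m] of the falling product. *)
  intros H; unfold gbinom; replace k with (m + S (k - S m))%nat at 1 by lia.
  change (S (k - S m)) with (1 + (k - S m))%nat.
  rewrite !falling_add; simpl.
  unfold Rdiv; ring.
Qed.

(** The explicit test is there because truncated subtraction gives [(n - k)! = 1] for [k > n], where
    the reciprocal factorial should be 0. *)
Definition coef (alpha : R) (n m k : nat) : R :=
  if (Nat.leb k n && Nat.leb k m)%bool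
  then / (poch alpha k * INR (fact k) * INR (fact (n - k)) * INR (fact (m - k)))
  else 0.

Lemma coef_in (alpha : R) (i j k : nat) :
  coef alpha (k + i) (k + j) k =
  / (poch alpha k * INR (fact k) * INR (fact i) * INR (fact j)).
Proof.
  unfold coef; replace (Nat.leb k (k + i)) with true by (symmetry; apply Nat.leb_le; lia).
  replace (Nat.leb k (k + j)) with true by (symmetry; apply Nat.leb_le; lia).
  simpl; do 4 f_equal; try lia; do 2 f_equal; lia.
Qed.

Lemma coef_out_l (alpha : R) (n m k : nat) : (n < k)%nat -> coef alpha n m k = 0.
Proof.
  intros H; unfold coef; now replace (Nat.leb k n) with false by (symmetry; apply Nat.leb_gt; lia).
Qed.

Lemma coef_sym (alpha : R) (n m k : nat) : coef alpha n m k = coef alpha m n k.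
Proof.
  unfold coef; rewrite Bool.andb_comm.
  destruct (Nat.leb k m && Nat.leb k n)%bool; [f_equal; ring|easy].
Qed.

Lemma coef_out_r (alpha : R) (n m k : nat) : (m < k)%nat -> coef alpha n m k = 0.
Proof. rewrite coef_sym; apply coef_out_l. Qed.

(** Since [(m + 1 - k) / (m + 1 - k)! = 1 / (m - k)!]; at [k = m + 1] both sides vanish. *)
Lemma coef_pred (alpha : R) (n m k : nat) : -1 < alpha ->
  coef alpha n m k = (INR (S m) - INR k) * coef alpha n (S m) k.
Proof.
  intros H.
  destruct (le_lt_dec k n) as [Hn|Hn]; [|rewrite !coef_out_l by lia; ring].
  destruct (le_lt_dec k m) as [Hm|Hm].
  - replace n with (k + (n - k))%nat by lia; replace m with (k + (m - k))%nat by lia.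
    generalize (n - k)%nat (m - k)%nat; intros i j.
    rewrite <- Nat.add_succ_r, !coef_in.
    rewrite fact_simpl, mult_INR, plus_INR, !S_INR.
    assert (P := poch_pos alpha k H); assert (Q := pos_INR j).
    field; repeat split; try apply INR_fact_neq_0; lra.
  - rewrite coef_out_r by lia.
    destruct (le_lt_dec k (S m)); [replace k with (S m) by lia; ring|].
    rewrite coef_out_r by lia; ring.
Qed.

(** The source of the telescoping. For [k < n] and [k <= m], division by [coef alpha n (S m) (S k)]
    reduces it to [(k+1)(k+1+alpha) = (m+1)(m+1+alpha) - (m+2+k+alpha)(m-k)]. *)
Lemma coef_diag (alpha : R) (n m k : nat) : -1 < alpha ->
  (INR n - INR k) * coef alpha n m k =
  (INR m + 1) * (INR m + 1 + alpha) * coef alpha n (S m) (S k)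
  - (INR m + 2 + INR k + alpha) * coef alpha n m (S k).
Proof.
  intros H.
  destruct (le_lt_dec k n) as [Hn|Hn]; [|rewrite !coef_out_l by lia; ring].
  destruct (Nat.eq_dec k n) as [->|Hn']; [rewrite !(coef_out_l alpha n _ (S n)) by lia; ring|].
  destruct (le_lt_dec k m) as [Hm|Hm]; [|rewrite !coef_out_r by lia; ring].
  destruct (Nat.le_exists_sub (S k) n) as [i [-> _]]; [lia|].
  destruct (Nat.le_exists_sub k m Hm) as [j [-> _]].
  replace (coef alpha (i + S k) (j + k) k) with (coef alpha (k + S i) (k + j) k)
    by (f_equal; lia).
  replace (coef alpha (i + S k) (S (j + k)) (S k)) with
    (coef alpha (S k + i) (S k + j) (S k)) by (f_equal; lia).
  rewrite !coef_in.
  assert (P := poch_pos alpha k H); assert (Q := pos_INR i); assert (Q' := pos_INR k).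
  (* For [j = 0], that is [m = k], the last coefficient is out of range and equals 0. *)
  destruct j as [|j].
  - rewrite (coef_out_r _ _ _ (S k)) by lia.
    rewrite poch_S, !fact_simpl, !mult_INR, !plus_INR, !S_INR; simpl.
    field; repeat split; try apply INR_fact_neq_0; lra.
  - replace (coef alpha (i + S k) (S j + k) (S k)) with
      (coef alpha (S k + i) (S k + j) (S k)) by (f_equal; lia).
    rewrite coef_in.
    rewrite poch_S, !fact_simpl, !mult_INR, !plus_INR, !S_INR.
    assert (Q'' := pos_INR j); field; repeat split; try apply INR_fact_neq_0; lra.
Qed.

(** The instance [k = -1] of [coef_diag], with coefficients at index -1 read as 0; it makes the
    telescoping start at 0. *)
Lemma coef_diag_0 (alpha : R) (n m : nat) : -1 < alpha ->
  0 = (INR m + 1) * (INR m + 1 + alpha) * coef alpha n (S m) 0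
      - (INR m + 1 + alpha) * coef alpha n m 0.
Proof. intros H; rewrite (coef_pred alpha n m 0 H), S_INR; simpl; ring. Qed.

(** * The functions [(1 + i t)^-(1 + alpha)] and [1 / (1 + i t)] *)

(** The quotient inside [acos] is [1 / sqrt (1 + t^2) = cos (atan t)]; [acos] returns [|atan t|],
    and the case split in [Carg] restores the sign. *)
Lemma Carg_1_plus_it (t : R) : Carg (1 + Ci * RtoC t)%C = atan t.
Proof.
  assert (R1 : Re (1 + Ci * RtoC t)%C = 1) by (simpl; ring).
  assert (I1 : Im (1 + Ci * RtoC t)%C = t) by (simpl; ring).
  assert (M1 : Cmod (1 + Ci * RtoC t)%C = sqrt (1 + t²)).
  { unfold Cmod; f_equal; unfold Rsqr; simpl; ring. }
  assert (HPI := PI_RGT_0).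
  unfold Carg; rewrite R1, I1, M1, <- cos_atan.
  destruct (Rle_dec 0 t) as [H|H].
  - apply acos_cos; generalize (atan_bound t); intros [_ B]; split; [|lra].
    destruct H as [H|<-]; [|rewrite atan_0; lra].
    left; rewrite <- atan_0; now apply atan_increasing.
  - rewrite <- (Ropp_involutive (atan t)) at 2; f_equal.
    rewrite <- cos_neg; apply acos_cos.
    generalize (atan_bound t); intros [B _]; split; [|lra].
    assert (atan t < atan 0) by (apply atan_increasing; lra).
    rewrite atan_0 in *; lra.
Qed.

Definition prefactor (alpha t : R) : C :=
  (1 / Cpower (1 + Ci * RtoC t) (RtoC (1 + alpha)))%C.

(** From [log (1 + i t) = ln (1 + t^2) / 2 + i atan t]. Both components become elementary real
    functions, ready for differentiation. *)
Lemma prefactor_polar (alpha t : R) :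
  prefactor alpha t =
  (exp (- ((1 + alpha) / 2 * ln (1 + t ^ 2))) * cos ((1 + alpha) * atan t),
   - (exp (- ((1 + alpha) / 2 * ln (1 + t ^ 2))) * sin ((1 + alpha) * atan t))).
Proof.
  assert (P : 0 < 1 + t ^ 2) by nra.
  assert (L : Clog (1 + Ci * RtoC t)%C = (/ 2 * ln (1 + t ^ 2), atan t)).
  { unfold Clog; rewrite Carg_1_plus_it; f_equal.
    replace (Cmod (1 + Ci * RtoC t)%C) with (sqrt (1 + t ^ 2))
      by (unfold Cmod; f_equal; simpl; ring).
    rewrite <- (sqrt_sqrt (1 + t ^ 2)) at 2 by lra.
    rewrite ln_mult by (apply sqrt_lt_R0; lra); lra. }
  unfold prefactor, Cpower; rewrite L; unfold Cexp.
  assert (E1 : Re (Cmult (RtoC (1 + alpha)) (/ 2 * ln (1 + t ^ 2), atan t))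
    = (1 + alpha) / 2 * ln (1 + t ^ 2)) by (simpl; field).
  assert (E2 : Im (Cmult (RtoC (1 + alpha)) (/ 2 * ln (1 + t ^ 2), atan t))
    = (1 + alpha) * atan t) by (simpl; ring).
  rewrite E1, E2, exp_Ropp.
  set (A := exp _); set (B := _ * atan t).
  assert (HA : 0 < A) by apply exp_pos.
  generalize (sin2_cos2 B); unfold Rsqr; intros HB.
  assert (Q : (A * cos B) ^ 2 + (A * sin B) ^ 2 = A * A).
  { transitivity (A * A * (sin B * sin B + cos B * cos B)); [ring|rewrite HB; ring]. }
  unfold Cdiv, Cinv; simpl fst; simpl snd; rewrite Q.
  apply injective_projections; simpl; field; lra.
Qed.

Definition qf (t : R) : C := (/ (1 + Ci * RtoC t))%C.

Lemma qf_pair (t : R) : qf t = (/ (1 + t ^ 2), - t / (1 + t ^ 2)).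
Proof.
  unfold qf, Cinv; apply injective_projections; simpl; field; nra.
Qed.

Lemma qf_derive (t : R) : is_Cderive qf t (- Ci * (qf t * qf t))%C.
Proof.
  rewrite qf_pair.
  apply (is_Cderive_ext (fun t => (/ (1 + t ^ 2), - t / (1 + t ^ 2))));
    [intros s; now rewrite qf_pair|].
  split; simpl; (auto_derive; [nra|]); field; nra.
Qed.

Lemma prefactor_derive (alpha t : R) :
  is_Cderive (prefactor alpha) t
    (- Ci * (RtoC (1 + alpha) * qf t * prefactor alpha t))%C.
Proof.
  rewrite qf_pair, prefactor_polar.
  apply (is_Cderive_ext (fun t =>
    (exp (- ((1 + alpha) / 2 * ln (1 + t ^ 2))) * cos ((1 + alpha) * atan t),
     - (exp (- ((1 + alpha) / 2 * ln (1 + t ^ 2))) * sin ((1 + alpha) * atan t)))));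
    [intros s; now rewrite prefactor_polar|].
  split; simpl; (auto_derive; [nra|]);
    unfold Rsqr; field; nra.
Qed.

(** The modulus is [(1 + t^2)^(-(1 + alpha)/2)], whose exponent is negative. *)
Lemma prefactor_bound (alpha t : R) : -1 < alpha -> Cmod (prefactor alpha t) <= 1.
Proof.
  intros H; rewrite prefactor_polar; unfold Cmod; cbn [fst snd].
  set (A := (1 + alpha) / 2 * ln (1 + t ^ 2)); set (B := _ * atan t).
  replace (_ ^ 2 + _ ^ 2) with (exp (- A) ^ 2).
  2:{ generalize (sin2_cos2 B); unfold Rsqr; intros HB.
      transitivity (exp (- A) ^ 2 * (sin B * sin B + cos B * cos B)); [rewrite HB|]; ring. }
  rewrite sqrt_pow2 by (left; apply exp_pos).
  rewrite <- exp_0; destruct (Req_dec A 0) as [->|HA]; [rewrite Ropp_0; lra|].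
  left; apply exp_increasing.
  assert (0 <= A); [|lra].
  apply Rmult_le_pos; [lra|rewrite <- ln_1; apply ln_le; nra].
Qed.

(** The value is below 1 and increases with [|t|], which yields geometric decay uniformly on bounded
    time intervals. *)
Lemma qf_minus_1_bound (t : R) : Cmod (qf t - 1)%C ^ 2 = 1 - / (1 + t ^ 2).
Proof. rewrite Cmod2_alt, qf_pair; simpl; field; nra. Qed.

(** * The recurrence for the Jacobi sums *)

Lemma Csum_n_S (f : nat -> C) (n : nat) : sum_n f (S n) = (sum_n f n + f (S n))%C.
Proof. now rewrite sum_Sn. Qed.

Lemma Csum_n_extend (f : nat -> C) (n d : nat) :
  (forall k, (n < k)%nat -> f k = 0) -> sum_n f (d + n) = sum_n f n.
Proof.
  intros H; induction d as [|d IH]; [easy|].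
  simpl; rewrite Csum_n_S, IH, H by lia; apply Cplus_0_r.
Qed.

(** The truncated exponent [n + m - 2 * k] is exact whenever the coefficient is nonzero. *)
Definition jac_term (alpha : R) (n m : nat) (q : C) (k : nat) : C :=
  (RtoC (coef alpha n m k) * (q ^ (2 * k) * (q - 1) ^ (n + m - 2 * k)))%C.

Definition jac_sum (alpha : R) (n m : nat) (q : C) : C := sum_n (jac_term alpha n m q) n.

(** Extended by zero terms to the common limit [n + m], the two sums agree term by term. *)
Lemma jac_sum_sym (alpha : R) (n m : nat) (q : C) :
  jac_sum alpha n m q = jac_sum alpha m n q.
Proof.
  unfold jac_sum.
  rewrite <- (Csum_n_extend _ n m), <- (Csum_n_extend _ m n), Nat.add_comm.
  - apply sum_n_ext; intros k; unfold jac_term.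
    now rewrite coef_sym, (Nat.add_comm n m).
  - intros k Hk; unfold jac_term; rewrite coef_out_l by easy; apply Cmult_0_l.
  - intros k Hk; unfold jac_term; rewrite coef_out_l by easy; apply Cmult_0_l.
Qed.

(* [q^2] times the derivative of [jac_term] with respect to [q]. *)
Definition jac_dterm (alpha : R) (n m : nat) (q : C) (k : nat) : C :=
  (RtoC (coef alpha n m k) *
   (RtoC (INR (2 * k)) * q ^ (S (2 * k)) * (q - 1) ^ (n + m - 2 * k)
    + q ^ (S (S (2 * k))) * (RtoC (INR (n + m - 2 * k)) * (q - 1) ^ pred (n + m - 2 * k))))%C.

(** For [m >= 1] this is [jac_term] at [m - 1], by [coef_pred]; keeping the index [m] includes the
    case [m = 0]. *)
Definition jac_lower (alpha : R) (n m : nat) (q : C) (k : nat) : C :=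
  (RtoC ((INR m - INR k) * coef alpha n m k)
   * (q ^ (2 * k) * (q - 1) ^ pred (n + m - 2 * k)))%C.

(* After homogenisation with [1 = q - (q - 1)] the two sides agree up to the
   telescoping difference of these quantities. *)
Definition jac_tele (alpha : R) (n m : nat) (q : C) (k : nat) : C :=
  (RtoC ((INR m + 1) * (INR m + 1 + alpha) * coef alpha n (S m) k
         - (INR m + 1 + INR k + alpha) * coef alpha n m k)
   * (q ^ (2 * k) * (q - 1) ^ (n + S m - 2 * k)))%C.

Lemma jac_tele_0 (alpha : R) (n m : nat) (q : C) : -1 < alpha -> jac_tele alpha n m q 0 = 0.
Proof.
  intros H; unfold jac_tele; simpl INR; rewrite Rplus_0_r, <- coef_diag_0 by easy.
  apply Cmult_0_l.
Qed.

Lemma jac_tele_S (alpha : R) (n m : nat) (q : C) (k : nat) : -1 < alpha ->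
  jac_tele alpha n m q (S k) =
  (RtoC ((INR n - INR k) * coef alpha n m k)
   * (q ^ (S (S (2 * k))) * (q - 1) ^ pred (n + m - 2 * k)))%C.
Proof.
  intros H; unfold jac_tele; rewrite coef_diag, S_INR by easy.
  replace (2 * S k)%nat with (S (S (2 * k))) by lia.
  replace (n + S m - S (S (2 * k)))%nat with (pred (n + m - 2 * k)) by lia.
  do 2 f_equal; ring.
Qed.

(** After [jac_tele_S] only coefficients at [k] occur, and what remains is a polynomial identity in
    [q] and these coefficients. *)
Lemma jac_term_recurrence (alpha : R) (n m : nat) (q : C) (k : nat) :
  -1 < alpha -> (k <= n)%nat ->
  (jac_lower alpha n m q k + RtoC (2 * INR m + 1 + alpha) * jac_term alpha n m q k
   + RtoC ((INR m + 1) * (INR m + 1 + alpha)) * jac_term alpha n (S m) q k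
   + jac_tele alpha n m q (S k) =
   RtoC (1 + alpha) * q * jac_term alpha n m q k + jac_dterm alpha n m q k
   + jac_tele alpha n m q k)%C.
Proof.
  intros H Hn; rewrite jac_tele_S by easy.
  unfold jac_lower, jac_term, jac_dterm, jac_tele.
  destruct (le_lt_dec k m) as [Hm|Hm].
  (* For [k > m] only [coef alpha n (S m) k] can be nonzero, and it enters both sides
     identically. *)
  2:{ rewrite (coef_out_r alpha n m) by easy; repeat (rewrite ?RtoC_minus, ?RtoC_plus, ?RtoC_mult); ring. }
  replace (n + S m - 2 * k)%nat with (S (n + m - 2 * k)) by lia.
  assert (E : INR (n + m - 2 * k) = INR n + INR m - 2 * INR k).
  { rewrite minus_INR by lia; rewrite plus_INR, mult_INR; simpl; ring. }
  rewrite E, mult_INR; change (INR 2) with 2.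
  generalize (coef alpha n m k) (coef alpha n (S m) k); intros c c'.
  (* If the exponent is 0 then [k = n = m], and the terms with the truncated [pred] carry a
     vanishing factor. *)
  destruct (n + m - 2 * k)%nat as [|j] eqn:Hj.
  - replace n with k by lia; replace m with k by lia.
    simpl Cpow; repeat (rewrite ?RtoC_minus, ?RtoC_plus, ?RtoC_mult); ring.
  - simpl pred; simpl Cpow.
    repeat (rewrite ?RtoC_minus, ?RtoC_plus, ?RtoC_mult); ring.
Qed.

Lemma jac_sum_recurrence (alpha : R) (n m : nat) (q : C) : -1 < alpha ->
  (RtoC (1 + alpha) * q * jac_sum alpha n m q + sum_n (jac_dterm alpha n m q) n =
   sum_n (jac_lower alpha n m q) n + RtoC (2 * INR m + 1 + alpha) * jac_sum alpha n m q
   + RtoC ((INR m + 1) * (INR m + 1 + alpha)) * jac_sum alpha n (S m) q)%C.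
Proof.
  intros H; unfold jac_sum.
  (* Partial sums leave the boundary term at [N + 1]; at [N = n] it vanishes through the factor
     [INR n - INR n]. *)
  assert (G : forall N, (N <= n)%nat ->
    (RtoC (1 + alpha) * q * sum_n (jac_term alpha n m q) N + sum_n (jac_dterm alpha n m q) N =
     sum_n (jac_lower alpha n m q) N + RtoC (2 * INR m + 1 + alpha) * sum_n (jac_term alpha n m q) N
     + RtoC ((INR m + 1) * (INR m + 1 + alpha)) * sum_n (jac_term alpha n (S m) q) N
     + jac_tele alpha n m q (S N))%C).
  { induction N as [|N IH]; intros HN.
    - rewrite !sum_O; generalize (jac_term_recurrence alpha n m q 0 H HN).
      rewrite jac_tele_0 by easy; intros E.
      rewrite E; ring.
    - rewrite !Csum_n_S.
      generalize (jac_term_recurrence alpha n m q (S N) H HN) (IH ltac:(lia)).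
      set (x1 := jac_lower _ _ _ _ _); set (x2 := jac_term _ _ m _ _);
      set (x3 := jac_term _ _ (S m) _ _); set (x4 := jac_tele _ _ _ _ (S (S N)));
      set (x5 := jac_dterm _ _ _ _ _); set (x6 := jac_tele _ _ _ _ (S N)).
      intros E1 E2.
      assert (E3 : (RtoC (1 + alpha) * q * x2 + x5 = x1 + RtoC (2 * INR m + 1 + alpha) * x2
        + RtoC ((INR m + 1) * (INR m + 1 + alpha)) * x3 + x4 - x6)%C) by (rewrite E1; ring).
      match type of E2 with (?a + ?b = _)%C =>
        transitivity (a + b + (RtoC (1 + alpha) * q * x2 + x5))%C; [ring|] end.
      rewrite E2, E3; ring. }
  rewrite (G n (le_n n)), jac_tele_S, Rminus_diag, Rmult_0_l by easy; ring.
Qed.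

(** * The explicit solution of the evolution equation *)

Definition offdiag (alpha : R) (m : nat) : R := sqrt (INR m * (INR m + alpha)).

Lemma offdiag_arg_pos (alpha : R) (m : nat) : -1 < alpha ->
  0 < INR (S m) * (INR (S m) + alpha).
Proof.
  intros H; rewrite S_INR; generalize (pos_INR m); intros; apply Rmult_lt_0_compat; lra.
Qed.

Lemma offdiag_0 (alpha : R) : offdiag alpha 0 = 0.
Proof. unfold offdiag; simpl; rewrite Rmult_0_l; apply sqrt_0. Qed.

Lemma offdiag_S_pos (alpha : R) (m : nat) : -1 < alpha -> 0 < offdiag alpha (S m).
Proof. intros H; apply sqrt_lt_R0, offdiag_arg_pos, H. Qed.

Lemma offdiag_S_sqr (alpha : R) (m : nat) : -1 < alpha ->
  offdiag alpha (S m) * offdiag alpha (S m) = (INR m + 1) * (INR m + 1 + alpha).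
Proof.
  intros H; unfold offdiag; rewrite sqrt_sqrt by (left; now apply offdiag_arg_pos).
  now rewrite S_INR.
Qed.

(** For [alpha > -1] this is the product [a_1 ... a_n] of off-diagonal entries, by [weight_S]; the
    normalisation makes the recurrence symmetric. *)
Definition weight (alpha : R) (n : nat) : R := sqrt (poch alpha n * INR (fact n)).

Lemma weight_arg_pos (alpha : R) (n : nat) : -1 < alpha -> 0 < poch alpha n * INR (fact n).
Proof. intros H; apply Rmult_lt_0_compat; [now apply poch_pos|apply INR_fact_lt_0]. Qed.

Lemma weight_pos (alpha : R) (n : nat) : -1 < alpha -> 0 < weight alpha n.
Proof. intros H; apply sqrt_lt_R0, weight_arg_pos, H. Qed.

Lemma weight_S (alpha : R) (n : nat) : -1 < alpha ->
  weight alpha (S n) = offdiag alpha (S n) * weight alpha n.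
Proof.
  intros H; unfold weight, offdiag.
  rewrite <- sqrt_mult by (left; first [now apply offdiag_arg_pos|now apply weight_arg_pos]).
  f_equal; rewrite poch_S, fact_simpl, mult_INR, S_INR; ring.
Qed.

Lemma weight_0 (alpha : R) : weight alpha 0 = 1.
Proof. unfold weight, poch; simpl; rewrite Rmult_1_r; apply sqrt_1. Qed.

(* Qualified because [Stdlib.Reals] exports another [sigma]. *)
Lemma sigma_weight (alpha : R) (n : nat) : -1 < alpha ->
  Defs.sigma alpha n = weight alpha n / INR (fact n).
Proof.
  intros H; unfold Defs.sigma, gbinom; change (falling (INR n + alpha) n) with (poch alpha n).
  generalize (INR_fact_lt_0 n) (poch_pos alpha n H); intros F P.
  apply sqrt_lem_1; [apply Rlt_le, Rdiv_lt_0_compat; easy| |].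
  - apply Rlt_le, Rdiv_lt_0_compat; [now apply weight_pos|easy].
  - transitivity (weight alpha n * weight alpha n / (INR (fact n) * INR (fact n))); [field; lra|].
    unfold weight; rewrite sqrt_sqrt by (left; now apply weight_arg_pos); field; lra.
Qed.

Definition evol (alpha : R) (n m : nat) (t : R) : C :=
  (RtoC (weight alpha n * weight alpha m) * (prefactor alpha t * jac_sum alpha n m (qf t)))%C.

Lemma evol_sym (alpha : R) (n m : nat) (t : R) : evol alpha n m t = evol alpha m n t.
Proof. unfold evol; now rewrite jac_sum_sym, Rmult_comm. Qed.

(** Chain rule with [q' = - i q^2]; the factor [q^2] is already inside [jac_dterm]. *)
Lemma jac_sum_derive (alpha : R) (n m : nat) (t : R) :
  is_Cderive (fun s => jac_sum alpha n m (qf s)) t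
    (- Ci * sum_n (jac_dterm alpha n m (qf t)) n)%C.
Proof.
  assert (D : forall k, is_Cderive (fun s => jac_term alpha n m (qf s) k) t
    (- Ci * jac_dterm alpha n m (qf t) k)%C).
  { intros k; unfold jac_term, jac_dterm; eapply is_Cderive_eq.
    - apply is_Cderive_scal.
      apply (is_Cderive_mult (fun s => qf s ^ (2 * k))%C).
      + apply is_Cderive_pow, qf_derive.
      + apply (is_Cderive_pow (fun s => qf s - 1)%C).
        apply is_Cderive_plus; [apply qf_derive|apply (is_Cderive_const (- (1)))].
    - generalize (n + m - 2 * k)%nat; intros j.
      destruct (2 * k)%nat as [|i]; simpl Cpow; simpl pred; [simpl INR|]; ring. }
  eapply is_Cderive_eq; [apply is_Cderive_sum_n, D|].
  (* Frees the upper limits from the [n] inside the terms, so that induction on the limit is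
     possible. *)
  generalize n at 2 4; intros N; induction N as [|N IH]; [now rewrite !sum_O|].
  rewrite !Csum_n_S, IH; ring.
Qed.

(** This is [jac_sum_recurrence] multiplied by the weights: [weight_S] turns the factors 1 and
    [a_(m+1)^2] of the neighbouring sums into [a_m] and [a_(m+1)]. *)
Lemma evol_derive (alpha : R) (n m : nat) (t : R) : -1 < alpha ->
  is_Cderive (evol alpha n m) t
    (- Ci * (RtoC (offdiag alpha m) * evol alpha n (pred m) t
       + RtoC (2 * INR m + 1 + alpha) * evol alpha n m t
       + RtoC (offdiag alpha (S m)) * evol alpha n (S m) t))%C.
Proof.
  intros H; eapply is_Cderive_eq.
  - apply is_Cderive_scal.
    apply (is_Cderive_mult (prefactor alpha)); [apply prefactor_derive|apply jac_sum_derive].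
  - assert (L : (RtoC (weight alpha n * weight alpha m) * sum_n (jac_lower alpha n m (qf t)) n
      = RtoC (offdiag alpha m) *
        (RtoC (weight alpha n * weight alpha (pred m)) * jac_sum alpha n (pred m) (qf t)))%C).
    { destruct m as [|m].
      - rewrite offdiag_0.
        replace (sum_n (jac_lower alpha n 0 (qf t)) n) with (RtoC 0); [simpl; ring|].
        symmetry; transitivity (sum_n (fun _ => RtoC 0) n).
        + apply sum_n_ext; intros k; unfold jac_lower.
          (* At [m = 0] the index [k = 0] has the factor [m - k = 0], and larger [k] are out of
             range. *)
          destruct k as [|k]; [simpl INR; rewrite Rminus_diag|rewrite coef_out_r by lia];
            rewrite ?Rmult_0_l, ?Rmult_0_r; apply Cmult_0_l.
        + induction n as [|N IH]; [now rewrite sum_O|rewrite Csum_n_S, IH; ring].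
      - simpl pred; rewrite weight_S by easy.
        replace (sum_n (jac_lower alpha n (S m) (qf t)) n) with (jac_sum alpha n m (qf t)).
        + rewrite !RtoC_mult; ring.
        + apply sum_n_ext; intros k; unfold jac_lower, jac_term.
          rewrite <- coef_pred by easy; do 3 f_equal; lia. }
    assert (E := jac_sum_recurrence alpha n m (qf t) H).
    unfold evol; rewrite weight_S by easy.
    transitivity (- Ci * prefactor alpha t * RtoC (weight alpha n * weight alpha m) *
      (RtoC (1 + alpha) * qf t * jac_sum alpha n m (qf t)
       + sum_n (jac_dterm alpha n m (qf t)) n))%C; [ring|].
    rewrite E, <- offdiag_S_sqr by easy.
    transitivity (- Ci * prefactor alpha t * (
       (RtoC (weight alpha n * weight alpha m) * sum_n (jac_lower alpha n m (qf t)) n)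
       + RtoC (weight alpha n * weight alpha m) *
      (RtoC (2 * INR m + 1 + alpha) * jac_sum alpha n m (qf t) +
      RtoC (offdiag alpha (S m) * offdiag alpha (S m)) * jac_sum alpha n (S m) (qf t))))%C; [ring|].
    rewrite L, !RtoC_mult; ring.
Qed.

(** * The functions with first index 0: explicit form, initial values and decay *)

Lemma evol_col_0 (alpha : R) (m : nat) (t : R) : -1 < alpha ->
  evol alpha 0 m t = (RtoC (Defs.sigma alpha m) * (prefactor alpha t * (qf t - 1) ^ m))%C.
Proof.
  intros H; unfold evol, jac_sum; rewrite sum_O; unfold jac_term.
  rewrite weight_0, sigma_weight by easy.
  replace (0 + m - 2 * 0)%nat with m by lia.
  replace (coef alpha 0 m 0) with (/ INR (fact m)).
  - unfold Rdiv; rewrite !RtoC_mult; simpl Cpow; ring.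
  - unfold coef; simpl; rewrite Nat.sub_0_r; unfold poch; simpl; f_equal; ring.
Qed.

Lemma sigma_pos (alpha : R) (m : nat) : -1 < alpha -> 0 < Defs.sigma alpha m.
Proof.
  intros H; rewrite sigma_weight by easy.
  apply Rdiv_lt_0_compat; [now apply weight_pos|apply INR_fact_lt_0].
Qed.

(** At [t = 0] one has [q = 1], so [w = 0] and only [w^0] survives. *)
Lemma evol_col_0_at_0 (alpha : R) (m : nat) : -1 < alpha -> evol alpha 0 m 0 = delta 0 m.
Proof.
  intros H; rewrite evol_col_0 by easy.
  assert (Q : qf 0 = RtoC 1)
    by (rewrite qf_pair; apply injective_projections; simpl; field).
  assert (P : prefactor alpha 0 = RtoC 1).
  { rewrite prefactor_polar; replace (1 + 0 ^ 2) with 1 by ring.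
    rewrite ln_1, atan_0, !Rmult_0_r, Ropp_0, exp_0, cos_0, sin_0.
    apply injective_projections; simpl; ring. }
  rewrite P, Q; replace (1 - 1)%C with (RtoC 0) by ring.
  destruct m as [|m].
  - change (delta 0 0) with (RtoC 1); unfold Defs.sigma, gbinom; simpl.
    rewrite Rdiv_1_r, sqrt_1; ring.
  - change (delta 0 (S m)) with (RtoC 0); simpl Cpow; ring.
Qed.

Lemma sigma_sqr_S (alpha : R) (m : nat) : -1 < alpha ->
  Defs.sigma alpha (S m) ^ 2 =
  (INR m + 1 + alpha) / (INR m + 1) * Defs.sigma alpha m ^ 2.
Proof.
  intros H; rewrite !sigma_weight, weight_S by easy.
  replace ((offdiag alpha (S m) * weight alpha m / INR (fact (S m))) ^ 2) with
    (offdiag alpha (S m) * offdiag alpha (S m) * weight alpha m ^ 2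
     * (/ INR (fact (S m))) ^ 2) by (unfold Rdiv; ring).
  rewrite offdiag_S_sqr, fact_simpl, mult_INR, S_INR by easy.
  generalize (INR_fact_lt_0 m) (pos_INR m); intros; field; lra.
Qed.

Lemma is_lim_seq_inv_S : is_lim_seq (fun N => / INR (S N)) 0.
Proof.
  replace (Finite 0) with (Rbar_inv p_infty) by reflexivity.
  apply is_lim_seq_inv; [|discriminate].
  apply -> is_lim_seq_incr_1; apply is_lim_seq_INR.
Qed.

(** The ratio test is applied to the squares, whose consecutive ratios are rational in [N] and tend
    to [r < 1]; the terms of a convergent series tend to 0. *)
Lemma offdiag_sigma_geom (alpha r : R) : -1 < alpha -> 0 < r < 1 ->
  is_lim_seq (fun N => offdiag alpha (S N) * Defs.sigma alpha N * sqrt r ^ N) 0.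
Proof.
  intros H Hr.
  set (y := fun N => (INR N + 1) * (INR N + 1 + alpha) * Defs.sigma alpha N ^ 2 * r ^ N).
  assert (Pos : forall N, 0 < y N).
  { intros N; unfold y; generalize (pos_INR N); intros.
    repeat apply Rmult_lt_0_compat; try lra; try apply pow_lt; try lra; now apply sigma_pos. }
  assert (Y : is_lim_seq y 0).
  { apply (is_lim_seq_ext (fun N => Rabs (y N))); [intros N; apply Rabs_pos_eq; now left|].
    apply ex_series_lim_0, (ex_series_DAlembert y r); [lra|intros N; generalize (Pos N); lra|].
    apply (is_lim_seq_ext (fun N =>
      (1 + / INR (S N)) * (1 + (1 + alpha) * / INR (S N)) * r)).
    - intros N; rewrite Rabs_pos_eq by (apply Rlt_le, Rdiv_lt_0_compat; easy).
      unfold y; rewrite sigma_sqr_S, !S_INR by easy; simpl pow.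
      generalize (pos_INR N) (sigma_pos alpha N H) (pow_lt r N (proj1 Hr)); intros.
      field; lra.
    - replace (Finite r) with (Finite ((1 + 0) * (1 + (1 + alpha) * 0) * r))
        by (f_equal; ring).
      apply is_lim_seq_mult'; [apply is_lim_seq_mult'|apply is_lim_seq_const].
      + apply is_lim_seq_plus'; [apply is_lim_seq_const|apply is_lim_seq_inv_S].
      + apply is_lim_seq_plus'; [apply is_lim_seq_const|].
        apply is_lim_seq_mult'; [apply is_lim_seq_const|apply is_lim_seq_inv_S]. }
  apply (is_lim_seq_ext (fun N => sqrt (y N))).
  - intros N; assert (S := sigma_pos alpha N H).
    apply sqrt_lem_1; [now left| |].
    + repeat apply Rmult_le_pos;
        [apply sqrt_pos|lra|apply pow_le, sqrt_pos].
    + unfold y; rewrite <- offdiag_S_sqr by easy.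
      replace (r ^ N) with (sqrt r ^ N * sqrt r ^ N)
        by (rewrite <- Rpow_mult_distr, sqrt_sqrt by lra; easy).
      ring.
  - rewrite <- sqrt_0; apply (is_lim_seq_continuous sqrt y 0); [|easy].
    apply continuity_pt_sqrt; lra.
Qed.

Lemma evol_decay (alpha T : R) : -1 < alpha -> exists eps : nat -> R, is_lim_seq eps 0 /\
  forall N s, Rabs s <= T ->
    Rabs (offdiag alpha (S N)) * (Cmod (evol alpha 0 N s) + Cmod (evol alpha 0 (S N) s)) <= eps N.
Proof.
  (* An upper bound of [|q - 1|^2 = 1 - 1 / (1 + s^2)] for [|s| <= T]; the 2 in place of 1 keeps [r]
     positive when [T = 0]. *)
  intros H; set (r := 1 - / (2 + T ^ 2)).
  assert (I : 0 < / (2 + T ^ 2) < 1).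
  { split; [apply Rinv_0_lt_compat; nra|].
    rewrite <- Rinv_1; apply Rinv_lt_contravar; nra. }
  assert (Hr : 0 < r < 1) by (unfold r; lra).
  set (y := fun N => offdiag alpha (S N) * Defs.sigma alpha N * sqrt r ^ N).
  exists (fun N => y N + y (S N)); split.
  { replace (Finite 0) with (Finite (0 + 0)) by (f_equal; ring).
    apply is_lim_seq_plus'; [|apply -> is_lim_seq_incr_1]; now apply offdiag_sigma_geom. }
  intros N s Hs.
  assert (W : Cmod (qf s - 1)%C <= sqrt r).
  { rewrite <- (sqrt_pow2 (Cmod (qf s - 1)%C)) by apply Cmod_ge_0.
    apply sqrt_le_1_alt; rewrite qf_minus_1_bound; unfold r.
    assert (s ^ 2 <= T ^ 2) by (apply pow_maj_Rabs; easy).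
    assert (/ (2 + T ^ 2) <= / (1 + s ^ 2)) by (apply Rinv_le_contravar; nra).
    lra. }
  assert (B : forall M, Cmod (evol alpha 0 M s) <= Defs.sigma alpha M * sqrt r ^ M).
  { intros M; rewrite evol_col_0, !Cmod_mult, Cmod_R, Cmod_pow by easy.
    assert (S := sigma_pos alpha M H); rewrite Rabs_pos_eq by lra.
    apply Rmult_le_compat_l; [lra|].
    rewrite <- (Rmult_1_l (sqrt r ^ M)).
    apply Rmult_le_compat; [apply Cmod_ge_0|apply pow_le, Cmod_ge_0| |].
    - now apply prefactor_bound.
    - apply pow_incr; split; [apply Cmod_ge_0|easy]. }
  rewrite Rabs_pos_eq by apply sqrt_pos.
  (* The factor in front of both moduli is [a_(N+1)], while [y (S N)] contains [a_(N+2)]. *)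
  assert (A : offdiag alpha (S N) <= offdiag alpha (S (S N))).
  { apply sqrt_le_1_alt; rewrite !S_INR; generalize (pos_INR N); nra. }
  assert (P := offdiag_S_pos alpha N H); assert (P' := offdiag_S_pos alpha (S N) H).
  rewrite Rmult_plus_distr_l; apply Rplus_le_compat; unfold y; rewrite Rmult_assoc.
  - apply Rmult_le_compat_l; [lra|apply B].
  - apply Rmult_le_compat; [lra|apply Cmod_ge_0|lra|apply B].
Qed.

(** * Comparison with the closed form *)

Lemma CpowZ_of_nat (z : C) (d : nat) : CpowZ z (Z.of_nat d) = (z ^ d)%C.
Proof. destruct d as [|d]; [easy|]; simpl Z.of_nat; unfold CpowZ; now rewrite SuccNat2Pos.id_succ. Qed.

Lemma CpowZ_opp_of_nat (z : C) (d : nat) : CpowZ z (- Z.of_nat d) = (/ z ^ d)%C.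
Proof.
  destruct d as [|d]; [simpl; field; apply C1_nz|].
  simpl Z.of_nat; simpl Z.opp; unfold CpowZ; now rewrite SuccNat2Pos.id_succ.
Qed.

(** The exponents add up to [(m - n) + 2 (n - k) = n + m - 2 k], which is nonnegative: the apparent
    pole at [z = 0] disappears. *)
Lemma CpowZ_shift (z : C) (n m k : nat) : z <> 0 \/ (n <= m)%nat ->
  (k <= n)%nat -> (k <= m)%nat ->
  (CpowZ z (Z.of_nat m - Z.of_nat n) * (z ^ 2) ^ (n - k) = z ^ (n + m - 2 * k))%C.
Proof.
  intros H Hn Hm; rewrite <- Cpow_mult_r.
  destruct (le_lt_dec n m) as [L|L].
  - replace (Z.of_nat m - Z.of_nat n)%Z with (Z.of_nat (m - n)) by lia.
    rewrite CpowZ_of_nat, <- Cpow_add_r; f_equal; lia.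
  - destruct H as [H|H]; [|lia].
    replace (Z.of_nat m - Z.of_nat n)%Z with (- Z.of_nat (n - m))%Z by lia.
    rewrite CpowZ_opp_of_nat.
    replace (2 * (n - k))%nat with ((n - m) + (n + m - 2 * k))%nat by lia.
    rewrite Cpow_add_r; field; now apply Cpow_nz.
Qed.

Lemma RtoC_sum_n (f : nat -> R) (n : nat) :
  RtoC (sum_f_R0 f n) = sum_n (fun k => RtoC (f k)) n.
Proof.
  induction n as [|n IH]; [now rewrite sum_O|].
  rewrite Csum_n_S, <- IH; simpl; apply RtoC_plus.
Qed.

Lemma Csum_n_mult_l (c : C) (f : nat -> C) (n : nat) :
  (c * sum_n f n)%C = sum_n (fun k => c * f k)%C n.
Proof.
  induction n as [|n IH]; [now rewrite !sum_O|].
  rewrite !Csum_n_S, <- IH; ring.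
Qed.

(** Here [gbinom (INR m) k] is the second Jacobi binomial, as [n + beta = m]. The identity follows
    from [sigma_n = s_n / n!] and [s_n^2 = (alpha+1)_n n!], where [s_n] is the weight; for [k > m]
    both sides are 0. *)
Lemma jacobi_coef (alpha : R) (n m k : nat) : -1 < alpha -> (k <= n)%nat ->
  Defs.sigma alpha m / Defs.sigma alpha n
    * (gbinom (INR n + alpha) (n - k) * gbinom (INR m) k) =
  weight alpha n * weight alpha m * coef alpha n m k.
Proof.
  intros H Hn; destruct (le_lt_dec k m) as [Hm|Hm].
  2:{ rewrite gbinom_nat_0, coef_out_r by easy; ring. }
  rewrite gbinom_poch, gbinom_nat, !sigma_weight by easy.
  unfold coef; rewrite (proj2 (Nat.leb_le k n) Hn), (proj2 (Nat.leb_le k m) Hm); simpl.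
  assert (W : poch alpha n = weight alpha n * weight alpha n / INR (fact n)).
  { unfold weight; rewrite sqrt_sqrt by (left; now apply weight_arg_pos).
    field; apply INR_fact_neq_0. }
  rewrite W; generalize (poch_pos alpha k H) (weight_pos alpha n H); intros.
  field; repeat split; try apply INR_fact_neq_0; lra.
Qed.

Lemma t_plus_i_ratio (t : R) : ((RtoC t + Ci) / (RtoC t - Ci))%C = (1 - 2 * qf t)%C.
Proof.
  unfold qf; apply injective_projections; simpl; field; nra.
Qed.

Lemma t_ratio (t : R) : (RtoC t / (Ci - RtoC t))%C = (qf t - 1)%C.
Proof. unfold qf; apply injective_projections; simpl; field; nra. Qed.

(** Because [(x - 1) / 2 = - 1 / (1 + t^2)], [1 - 2 q = - (1 - i t) / (1 + i t)] and
    [1 + t^2 = (1 + i t) (1 - i t)]. *)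
Lemma jacobi_arg_minus (t : R) :
  ((1 - 2 * qf t) * RtoC (((t ^ 2 - 1) / (t ^ 2 + 1) - 1) / 2) = qf t ^ 2)%C.
Proof. rewrite qf_pair; apply injective_projections; simpl; field; nra. Qed.

Lemma jacobi_arg_plus (t : R) :
  ((1 - 2 * qf t) * RtoC (((t ^ 2 - 1) / (t ^ 2 + 1) + 1) / 2) = (qf t - 1) ^ 2)%C.
Proof. rewrite qf_pair; apply injective_projections; simpl; field; nra. Qed.

Lemma kernel_formula_evol (alpha : R) (n m : nat) (t : R) : -1 < alpha ->
  t <> 0 \/ (n <= m)%nat -> kernel_formula alpha n m t = evol alpha n m t.
Proof.
  intros H Ht; unfold kernel_formula.
  fold (prefactor alpha t); rewrite t_plus_i_ratio, t_ratio.
  set (x := (t ^ 2 - 1) / (t ^ 2 + 1)).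
  assert (Hw : (qf t - 1)%C <> 0 \/ (n <= m)%nat).
  { destruct Ht as [Ht|Ht]; [left|now right].
    rewrite qf_pair; intros E; apply (f_equal Im) in E; simpl in E.
    apply Ht; apply (Rmult_eq_reg_r (/ (1 + t ^ 2))); [|apply Rinv_neq_0_compat; nra].
    unfold Rdiv in E; simpl; lra. }
  unfold jacobi, evol, jac_sum; rewrite RtoC_sum_n.
  match goal with |- (?p * ?A * ?W * ?s * ?S)%C = (?c * (_ * ?S'))%C =>
    transitivity (p * ((A * W * s) * S))%C; [ring|transitivity (p * (c * S'))%C; [|ring]] end.
  f_equal; rewrite !Csum_n_mult_l.
  apply sum_n_ext_loc; intros k Hk; cbv beta.
  match goal with |- @eq _ ?a ?b => change (@eq C a b) end.
  replace (INR n + (INR m - INR n)) with (INR m) by ring.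
  set (g := gbinom (INR n + alpha) (n - k)); set (h := gbinom (INR m) k).
  unfold jac_term.
  (* The [n] factors [1 - 2 q] are shared out: [k] of them go to the powers of [(x - 1) / 2], the
     other [n - k] to those of [(x + 1) / 2]. *)
  transitivity (RtoC (Defs.sigma alpha m / Defs.sigma alpha n * (g * h))
    * (CpowZ (qf t - 1) (Z.of_nat m - Z.of_nat n)
       * (((1 - 2 * qf t) * RtoC ((x - 1) / 2)) ^ k
          * ((1 - 2 * qf t) * RtoC ((x + 1) / 2)) ^ (n - k))))%C.
  { rewrite !Cpow_mult_l; replace n with (k + (n - k))%nat at 1 by lia.
    rewrite Cpow_add_r, !RtoC_mult, !RtoC_pow; ring. }
  unfold x; rewrite jacobi_arg_minus, jacobi_arg_plus; unfold g, h.
  rewrite jacobi_coef by easy.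
  destruct (le_lt_dec k m) as [Hm|Hm]; [|rewrite coef_out_r by easy; rewrite Rmult_0_r; ring].
  rewrite <- (CpowZ_shift (qf t - 1)%C n m k Hw Hk Hm), (Cpow_mult_r (qf t) 2 k).
  rewrite !RtoC_mult; ring.
Qed.

(** * The unitary group and its kernel *)

Lemma is_series_single (f : nat -> R) (n : nat) :
  (forall j, j <> n -> f j = 0) -> is_series f (f n).
Proof.
  intros H; apply (is_lim_seq_ext_loc (fun _ => f n) (sum_n f) (f n)); [|apply is_lim_seq_const].
  assert (Z : forall N, (N < n)%nat -> sum_n f N = 0).
  { induction N as [|N IH]; intros HN; [rewrite sum_O; apply H; lia|].
    rewrite sum_Sn, IH, H by lia; apply Rplus_0_r. }
  exists n; intros N HN; induction HN as [|N HN IH].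
  - destruct n as [|n]; [now rewrite sum_O|].
    rewrite sum_Sn, Z by lia; symmetry; apply Rplus_0_l.
  - rewrite sum_Sn, <- IH, (H (S N)) by lia; symmetry; apply Rplus_0_r.
Qed.

Lemma delta_same (n : nat) : delta n n = RtoC 1.
Proof. unfold delta; now rewrite Nat.eqb_refl. Qed.

Lemma delta_other (n j : nat) : j <> n -> delta n j = RtoC 0.
Proof. intros H; unfold delta; now rewrite (proj2 (Nat.eqb_neq j n) H). Qed.

(** Valid for every sequence [v], since both series have at most one nonzero term. *)
Lemma inner_delta (n : nat) (v : nat -> C) : inner (delta n) v = v n.
Proof.
  apply injective_projections.
  - change (Series (fun j => Re (Cconj (delta n j) * v j)%C) = Re (v n)).
    replace (Re (v n)) with (Re (Cconj (delta n n) * v n)%C)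
      by (rewrite delta_same; simpl; unfold Re; ring).
    apply is_series_unique, (is_series_single (fun j => Re (Cconj (delta n j) * v j)%C)).
    intros j Hj; rewrite delta_other by easy; simpl; ring.
  - change (Series (fun j => Im (Cconj (delta n j) * v j)%C) = Im (v n)).
    replace (Im (v n)) with (Im (Cconj (delta n n) * v n)%C)
      by (rewrite delta_same; simpl; unfold Im; ring).
    apply is_series_unique, (is_series_single (fun j => Im (Cconj (delta n j) * v j)%C)).
    intros j Hj; rewrite delta_other by easy; simpl; ring.
Qed.

Lemma is_series_delta (n : nat) : is_series (fun j => Cmod (delta n j) ^ 2) 1.
Proof.
  replace 1 with (Cmod (delta n n) ^ 2) by (rewrite delta_same, Cmod_1; ring).
  apply (is_series_single (fun j => Cmod (delta n j) ^ 2)).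
  intros j Hj; rewrite delta_other, Cmod_0 by easy; ring.
Qed.

Lemma ell2_delta (n : nat) : ell2 (delta n).
Proof. exists 1; apply is_series_delta. Qed.

Lemma l2norm_delta (n : nat) : l2norm (delta n) = 1.
Proof. unfold l2norm; rewrite (is_series_unique _ _ (is_series_delta n)); apply sqrt_1. Qed.

(** By comparison, using [|x + y|^2 <= 2 |x|^2 + 2 |y|^2]. *)
Lemma ell2_lcomb (a b : C) (u v : nat -> C) : ell2 u -> ell2 v -> ell2 (lcomb a u b v).
Proof.
  intros Hu Hv.
  apply (ex_series_le (K := R_AbsRing) (V := R_CompleteNormedModule) _
    (fun j => 2 * Cmod a ^ 2 * Cmod (u j) ^ 2 + 2 * Cmod b ^ 2 * Cmod (v j) ^ 2)).
  - intros j; unfold norm; simpl; unfold abs; simpl.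
    change (Rabs (Cmod (lcomb a u b v j) ^ 2) <=
      2 * Cmod a ^ 2 * Cmod (u j) ^ 2 + 2 * Cmod b ^ 2 * Cmod (v j) ^ 2).
    rewrite Rabs_pos_eq by apply pow2_ge_0; unfold lcomb.
    generalize (Cmod_triangle (a * u j) (b * v j)); rewrite !Cmod_mult.
    generalize (Cmod_ge_0 (a * u j + b * v j)).
    set (z := Cmod (_ + _)); set (x := Cmod a * _); set (y := Cmod b * _); intros Z T.
    replace (2 * Cmod a ^ 2 * Cmod (u j) ^ 2) with (2 * x ^ 2) by (unfold x; ring).
    replace (2 * Cmod b ^ 2 * Cmod (v j) ^ 2) with (2 * y ^ 2) by (unfold y; ring).
    generalize (pow2_ge_0 (x - y)); nra.
  - apply (ex_series_plus (K := R_AbsRing) (V := R_NormedModule)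
      (fun j => 2 * Cmod a ^ 2 * Cmod (u j) ^ 2) (fun j => 2 * Cmod b ^ 2 * Cmod (v j) ^ 2));
      [now apply (ex_series_scal (V := R_NormedModule) (2 * Cmod a ^ 2)
          (fun j => Cmod (u j) ^ 2))
      |now apply (ex_series_scal (V := R_NormedModule) (2 * Cmod b ^ 2)
          (fun j => Cmod (v j) ^ 2))].
Qed.

Lemma Cmod_le_l2norm (u : nat -> C) (n : nat) : ell2 u -> Cmod (u n) <= l2norm u.
Proof.
  intros H; rewrite <- (sqrt_pow2 (Cmod (u n))) by apply Cmod_ge_0.
  apply sqrt_le_1_alt.
  set (f := fun j => if Nat.eqb j n then Cmod (u n) ^ 2 else 0).
  assert (F : f n = Cmod (u n) ^ 2) by (unfold f; now rewrite Nat.eqb_refl).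
  assert (S := is_series_single f n
    ltac:(intros j Hj; unfold f; now rewrite (proj2 (Nat.eqb_neq j n) Hj))).
  rewrite F in S; rewrite <- (is_series_unique _ _ S).
  apply Series_le; [|exact H].
  intros j; unfold f; destruct (Nat.eqb_spec j n) as [->|]; split;
    try apply pow2_ge_0; lra.
Qed.

Lemma Re_inner_self (u : nat -> C) : Re (inner u u) = Series (fun n => Cmod (u n) ^ 2).
Proof.
  apply Series_ext; intros n; rewrite Cmod2_alt; unfold Re, Im; simpl; ring.
Qed.

Lemma unitary_l2norm (V : (nat -> C) -> nat -> C) (u : nat -> C) :
  unitary V -> ell2 u -> l2norm (V u) = l2norm u.
Proof.
  intros HV Hu; unfold l2norm; now rewrite <- !Re_inner_self, (unitary_inner V HV).
Qed.

(** Serves twice: it bounds the kernel by 1, and it turns norm convergence of difference quotients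
    into entrywise convergence. *)
Lemma unitary_entry_bound (V : (nat -> C) -> nat -> C) (u : nat -> C) (n : nat) :
  unitary V -> ell2 u -> Cmod (V u n) <= l2norm u.
Proof.
  intros HV Hu; rewrite <- (unitary_l2norm V u HV Hu).
  now apply Cmod_le_l2norm, (unitary_ell2 V HV).
Qed.

(** * Differentiating the matrix entries of the group *)

Lemma is_derive_of_quotient (f : R -> R) (t l : R) :
  (forall eps : posreal, locally' 0 (fun h => Rabs ((f (t + h) - f t) / h - l) < eps)) ->
  is_derive f t l.
Proof.
  intros H; apply is_derive_Reals; intros eps Heps.
  destruct (H (mkposreal eps Heps)) as [d Hd]; exists d; intros h Hh Hd'.
  apply Hd; [|easy]. change (Rabs (h - 0) < d); now rewrite Rminus_0_r.
Qed.

(** By the group law, the difference quotient at [t] minus [U t v] is [U t] applied to the quotient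
    at 0 minus [v], and [U t] preserves the norm. *)
Lemma unitary_group_derive (U : R -> (nat -> C) -> nat -> C) (u v : nat -> C) (n : nat) (t : R) :
  unitary_group U -> generator_graph U u v -> is_Cderive (fun s => U s u n) t (U t v n).
Proof.
  intros HU [Hu [Hv G]].
  assert (K : forall eps : posreal, locally' 0 (fun h =>
    Cmod ((U (t + h)%R u n - U t u n) / RtoC h - U t v n)%C < eps)).
  { intros eps; generalize (G _ (locally_ball 0 eps)).
    assert (N0 : locally' 0 (fun h => h <> 0)) by (exists (mkposreal 1 Rlt_0_1); easy).
    unfold filtermap; intros G'; generalize (filter_and _ _ N0 G').
    apply filter_imp; intros h [Hh B].
    assert (HUt := ugroup_unitary U HU t).
    assert (HUh := ugroup_unitary U HU h).
    (* Nested [lcomb], the form in which linearity of [U t] is available. *)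
    set (w := lcomb 1 (lcomb (/ RtoC h) (U h u) (- / RtoC h) u) (- (1)) v).
    assert (Hw : ell2 w)
      by (unfold w; repeat apply ell2_lcomb; try easy; now apply (unitary_ell2 _ HUh)).
    assert (Ew : (fun j => ((U h u j - u j) / RtoC h - v j)%C) = w).
    { apply functional_extensionality; intros j; unfold w, lcomb, Cdiv; ring. }
    rewrite Ew in B.
    assert (E : ((U (t + h)%R u n - U t u n) / RtoC h - U t v n)%C = U t w n).
    { unfold w; rewrite !(unitary_linear _ HUt); try easy;
        try (apply ell2_lcomb; try easy); try now apply (unitary_ell2 _ HUh).
      rewrite (ugroup_plus U HU) by easy; unfold lcomb, Cdiv; ring. }
    rewrite E; eapply Rle_lt_trans; [now apply unitary_entry_bound|].
    change (Rabs (l2norm w - 0) < eps) in B; rewrite Rminus_0_r in B.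
    eapply Rle_lt_trans; [apply Rle_abs|exact B]. }
  assert (Q : forall (z y : C) (h : R), h <> 0 ->
    Re (z / RtoC h - y)%C = Re z / h - Re y /\ Im (z / RtoC h - y)%C = Im z / h - Im y).
  { intros z y h Hh; unfold Re, Im; split; simpl; field; easy. }
  assert (N0 : locally' 0 (fun h => h <> 0)) by (exists (mkposreal 1 Rlt_0_1); easy).
  split; apply is_derive_of_quotient; intros eps;
    generalize (filter_and _ _ N0 (K eps)); apply filter_imp; intros h [Hh B];
    (eapply Rle_lt_trans; [|exact B]);
    destruct (Q (U (t + h)%R u n - U t u n)%C (U t v n) h Hh) as [Q1 Q2].
  - eapply Rle_trans; [|apply re_le_Cmod]; rewrite Q1; apply Rle_refl.
  - eapply Rle_trans; [|apply im_le_Cmod]; rewrite Q2; apply Rle_refl.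
Qed.

(** Column [m] of the symmetric matrix. For [m = 0] the convention [pred 0 = 0] is harmless because
    [offdiag alpha 0 = 0]. *)
Lemma tau_delta (alpha : R) (m : nat) :
  tau alpha (delta m) =
  lcomb 1 (lcomb (RtoC (offdiag alpha m)) (delta (pred m)) (RtoC (2 * INR m + 1 + alpha)) (delta m))
    (RtoC (offdiag alpha (S m))) (delta (S m)).
Proof.
  apply functional_extensionality; intros j; unfold tau, lcomb.
  rewrite <- S_INR; fold (offdiag alpha j); fold (offdiag alpha (S j)).
  destruct j as [|j].
  - destruct m as [|[|m]]; simpl pred; rewrite ?offdiag_0, ?delta_same, ?delta_other by lia; ring.
  - destruct (Nat.eq_dec (S j) m) as [<-|H1].
    { simpl pred; rewrite !delta_same, !delta_other by lia; ring. }
    rewrite (delta_other m (S j)) by easy.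
    destruct (Nat.eq_dec j m) as [->|H2].
    { rewrite !delta_same, !delta_other by lia; ring. }
    rewrite (delta_other m j), (delta_other (S m) (S j)) by lia.
    destruct (Nat.eq_dec (S (S j)) m) as [<-|H3].
    { simpl pred; rewrite !delta_same; ring. }
    rewrite (delta_other m (S (S j))) by easy.
    destruct m as [|m]; [rewrite offdiag_0; ring|].
    simpl pred; rewrite (delta_other m) by lia; ring.
Qed.

Lemma ell2_tau_delta (alpha : R) (m : nat) : ell2 (tau alpha (delta m)).
Proof. rewrite tau_delta; repeat apply ell2_lcomb; apply ell2_delta. Qed.

Lemma kernel_entry (V : (nat -> C) -> nat -> C) (n m : nat) : kernel V n m = V (delta m) n.
Proof. apply inner_delta. Qed.

(** As [delta m] lies in the domain, the derivative is [U t] applied to [- i H delta_m]; hence the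
    recurrence runs in the second index. *)
Lemma kernel_derive (alpha : R) (U : R -> (nat -> C) -> nat -> C) (n m : nat) (t : R) :
  is_unitary_group_of (H_op alpha) U ->
  is_Cderive (fun s => kernel (U s) n m) t
    (- Ci * (RtoC (offdiag alpha m) * kernel (U t) n (pred m)
       + RtoC (2 * INR m + 1 + alpha) * kernel (U t) n m
       + RtoC (offdiag alpha (S m)) * kernel (U t) n (S m)))%C.
Proof.
  intros [HU HG]; rewrite !kernel_entry.
  apply (is_Cderive_ext (fun s => U s (delta m) n)); [intros s; now rewrite kernel_entry|].
  eapply is_Cderive_eq.
  - apply unitary_group_derive; [exact HU|].
    apply HG; split; [split; [apply ell2_delta|apply ell2_tau_delta]|reflexivity].
  - assert (HUt := ugroup_unitary U HU t).
    replace (fun j => (- Ci * op_act (H_op alpha) (delta m) j)%C)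
      with (lcomb (- Ci) (tau alpha (delta m)) 0 (delta m)).
    2:{ apply functional_extensionality; intros j; unfold lcomb; simpl; ring. }
    rewrite (unitary_linear _ HUt) by auto using ell2_delta, ell2_tau_delta.
    rewrite tau_delta.
    rewrite !(unitary_linear _ HUt) by auto using ell2_delta, ell2_lcomb.
    unfold lcomb; ring.
Qed.

Lemma kernel_evol (alpha : R) (U : R -> (nat -> C) -> nat -> C) (n m : nat) : -1 < alpha ->
  is_unitary_group_of (H_op alpha) U -> forall t, kernel (U t) n m = evol alpha n m t.
Proof.
  intros H HU.
  (* By symmetry column 0 of [evol] is its row 0, so uniqueness applies with
     [psi = evol alpha 0]. *)
  assert (C0 : forall t, kernel (U t) n 0 = evol alpha n 0 t).
  { intros t; rewrite evol_sym.
    apply (jacobi_evolution_unique (offdiag alpha) (fun m => 2 * INR m + 1 + alpha) n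
      (fun m t => kernel (U t) n m) (evol alpha 0)).
    - apply offdiag_0.
    - intros j s; now apply kernel_derive.
    - intros j s; now apply evol_derive.
    - intros j s; rewrite kernel_entry, <- (l2norm_delta j).
      apply unitary_entry_bound; [apply HU|apply ell2_delta].
    - intros j; rewrite kernel_entry, (ugroup_0 U (proj1 HU)) by apply ell2_delta.
      unfold delta; now rewrite Nat.eqb_sym.
    - intros j; now apply evol_col_0_at_0.
    - intros T; now apply evol_decay. }
  (* Equal functions have equal derivatives; the two right-hand sides can then differ only in the
     entry [j + 1], whose factor [a_(j+1)] is nonzero. *)
  assert (Step : forall j, (forall t, kernel (U t) n (pred j) = evol alpha n (pred j) t) ->
    (forall t, kernel (U t) n j = evol alpha n j t) ->
    forall t, kernel (U t) n (S j) = evol alpha n (S j) t).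
  { intros j IH1 IH2 t.
    assert (D := kernel_derive alpha U n j t HU).
    apply (is_Cderive_ext _ (evol alpha n j)) in D; [|exact IH2].
    assert (E := is_Cderive_unique _ _ _ _ D (evol_derive alpha n j t H)).
    rewrite IH1, IH2 in E.
    assert (P := offdiag_S_pos alpha j H).
    assert (P' : RtoC (offdiag alpha (S j)) <> 0) by (intros Z; apply RtoC_inj in Z; lra).
    assert (Solve : forall x k : C, k =
      ((Ci * (- Ci * (x + RtoC (offdiag alpha (S j)) * k)) - x) / RtoC (offdiag alpha (S j)))%C).
    { intros x k.
      assert (CC : forall z : C, (Ci * (- Ci * z) = z)%C)
        by (intros z; apply injective_projections; simpl; ring).
      rewrite CC; field; easy. }
    rewrite (Solve (RtoC (offdiag alpha j) * evol alpha n (pred j) t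
      + RtoC (2 * INR j + 1 + alpha) * evol alpha n j t)%C (evol alpha n (S j) t)), <- E.
    apply Solve. }
  (* Two consecutive indices are carried along; at [m = 0] both are column 0, because
     [pred 0 = 0]. *)
  assert (B : (forall t, kernel (U t) n (pred m) = evol alpha n (pred m) t) /\
    (forall t, kernel (U t) n m = evol alpha n m t)).
  { induction m as [|j [IH1 IH2]]; [easy|]; split; [exact IH2|now apply Step]. }
  apply B.
Qed.

Theorem theorem3p1 (alpha : R) (halpha : -1 < alpha)
    (U : R -> (nat -> C) -> nat -> C)
    (hU : is_unitary_group_of (H_op alpha) U)
    (n m : nat) (t : R) :
  kernel (U t) n m = kernel (U t) m n /\
  (t <> 0 \/ (n <= m)%nat ->
     kernel (U t) n m = kernel_formula alpha n m t) /\
  (t = 0 /\ (m < n)%nat ->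
     filterlim (kernel_formula alpha n m) (locally' 0)
       (locally (kernel (U t) n m))).
Proof.
  rewrite !(kernel_evol alpha) by easy; split; [apply evol_sym|split].
  - intros Ht; symmetry; now apply kernel_formula_evol.
  - intros [-> _].
    (* Away from [t = 0] the formula equals [evol], which is differentiable and hence continuous at
       0 too. *)
    apply (filterlim_ext_loc (evol alpha n m)).
    + exists (mkposreal 1 Rlt_0_1); intros s _ Hs.
      symmetry; apply kernel_formula_evol; [easy|now left].
    + eapply filterlim_filter_le_1; [apply filter_le_within|].
      eapply is_Cderive_filterlim; now apply evol_derive.
Qed.
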